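(* Let $f:\Sigma\to M$ be a differentiable immersion of a connected manifold $\Sigma$ in a Riemannian manifold $M$. Let $G:M\to\mathbb{R}$ be a Lipschitz function with Lipschitz constant $C>0$. Assume that for all $p\in\Sigma$ and any $v\in T_p\Sigma$ there exists a nontrivial (i.e. nonzero) vector $\eta\in T_{f(p)}M$ orthogonal to $df_p v$ such that the geodesic $\gamma_\eta:[0,1]\to M$ satisfies $$|G(f(p))-G(\gamma_\eta(1))|=C\,L(\gamma_\eta).$$ Then $f(\Sigma)$ is contained in a level set of $G$.
   Context: $\gamma_\eta:[0,1]\to M$ denotes the geodesic with $\gamma_\eta'(0)=\eta$ (assumed to be defined on $[0,1]$), and $L(\gamma_\eta)$ is its length. $G$ Lipschitz with constant $C$ means $|G(x)-G(y)|\le C\,d(x,y)$ for all $x,y\in M$, where $d$ is the Riemannian distance. The immersion $f$ is only assumed differentiable, not necessarily $C^1$. *)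

(* Defs.v *)
From HB Require Import structures.
From mathcomp Require Import all_boot all_order all_algebra.
From mathcomp Require Import all_classical all_reals all_analysis.

Set Implicit Arguments.
Unset Strict Implicit.
Unset Printing Implicit Defensive.

Import Order.TTheory GRing.Theory Num.Theory.
Import numFieldNormedType.Exports.

Local Open Scope classical_set_scope.
Local Open Scope ring_scope.

(* On an open set [U] of a finite-dimensional space, [Ck_on k U] is C^k. *)
Fixpoint Ck_on (R : realType) (V W : normedModType R) (k : nat) (U : set V)
    (h : V -> W) : Prop :=
  if k is k'.+1 then
    (forall x, U x -> differentiable h x) /\
    (forall v, Ck_on k' U (fun x => 'D_v h x))
  else forall x, U x -> {for x, continuous h}.

Definition smooth_on (R : realType) (V W : normedModType R) (U : set V)
    (h : V -> W) : Prop :=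
  forall k, Ck_on k U h.

(* Charts and their inverses are total functions; [chart i] is meaningful only
   on [dom i] and [param i] only on [codom i] = [chart i @` dom i].
   The atlas need not be maximal.  [chart_at] distinguishes a chart around every
   point; it expresses that the domains cover and is used below to write
   tangent vectors in coordinates. *)
Record manifold (R : realType) (n : nat) := Manifold {
  points :> topologicalType;
  atlas : Type;
  dom : atlas -> set points;
  chart : atlas -> points -> 'rV[R]_n;
  param : atlas -> 'rV[R]_n -> points;
  chart_at : points -> atlas;
  points_hausdorff : hausdorff_space points;
  points_second_countable : @second_countable points;
  dom_open : forall i, open (dom i);
  codom_open : forall i, open (chart i @` dom i);
  chartK : forall i p, dom i p -> param i (chart i p) = p;
  chart_continuous : forall i p, dom i p -> {for p, continuous (chart i)};
  param_continuous :
    forall i x, (chart i @` dom i) x -> {for x, continuous (param i)};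
  chart_at_dom : forall p, dom (chart_at p) p;
  transition_smooth : forall i j,
    smooth_on (chart i @` (dom i `&` dom j)) (chart j \o param i)
}.

Arguments dom {R n m} i _ : rename.
Arguments chart {R n m} i p : rename.
Arguments param {R n m} i x : rename.
Arguments chart_at {R n m} p : rename.

Definition codom (R : realType) (n : nat) (M : manifold R n) (i : atlas M) :
    set 'rV[R]_n :=
  chart i @` dom i.

(* T_pM is represented by R^n through the distinguished chart around [p]. *)
Definition tangent (R : realType) (n : nat) (M : manifold R n) (p : M) :=
  'rV[R]_n.

Definition differentiable_map (R : realType) (m n : nat) (S : manifold R m)
    (M : manifold R n) (f : S -> M) : Prop :=
  forall p, {for p, continuous f} /\
    forall (i : atlas S) (j : atlas M), dom i p -> dom j (f p) ->
      differentiable (chart j \o f \o param i) (chart i p).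

Definition differential (R : realType) (m n : nat) (S : manifold R m)
    (M : manifold R n) (f : S -> M) (p : S) : tangent p -> tangent (f p) :=
  'd (chart (chart_at (f p)) \o f \o param (chart_at p)) (chart (chart_at p) p).

Definition immersion (R : realType) (m n : nat) (S : manifold R m)
    (M : manifold R n) (f : S -> M) : Prop :=
  differentiable_map f /\ forall p, injective (differential f (p := p)).

Definition bilin (R : realType) (n : nat) (A : 'M[R]_n) (u v : 'rV[R]_n) : R :=
  (u *m A *m v^T) 0 0.

(* [gram i x] is the matrix (g_ab) of the metric in the chart [i], at the point
   of coordinates [x]. *)
Record riemannian_metric (R : realType) (n : nat) (M : manifold R n) :=
  RiemannianMetric {
  gram : atlas M -> 'rV[R]_n -> 'M[R]_n;
  gram_sym : forall i x, codom i x -> (gram i x)^T = gram i x;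
  gram_pos : forall i x, codom i x ->
    forall u, u != 0 -> 0 < bilin (gram i x) u u;
  gram_smooth : forall i a b, smooth_on (codom i) (fun x => gram i x a b : R);
  gram_compat : forall i j p, dom i p -> dom j p -> forall u v : 'rV[R]_n,
    bilin (gram i (chart i p)) u v =
    bilin (gram j (chart j p))
      ('d (chart j \o param i) (chart i p) u)
      ('d (chart j \o param i) (chart i p) v)
}.

Section Riemannian.
Variables (R : realType) (n : nat) (M : manifold R n) (g : riemannian_metric M).

Definition inner (p : M) (u v : tangent p) : R :=
  bilin (gram g (chart_at p) (chart (chart_at p) p)) u v.

Definition velocity (c : R -> M) (t : R) : tangent (c t) :=
  derive1 (chart (chart_at (c t)) \o c) t.

Definition curve_length (c : R -> M) (a b : R) : \bar R :=
  (\int[lebesgue_measure]_(t in `[a, b])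
    (Num.sqrt (inner (velocity c t) (velocity c t)))%:E)%E.

Definition C1_curve (I : set R) (c : R -> M) : Prop :=
  forall t, I t -> {for t, continuous c} /\
    forall i : atlas M, dom i (c t) ->
      derivable (chart i \o c) t 1 /\ {for t, continuous (derive1 (chart i \o c))}.

(* As usual for a closed interval: [c] is the restriction of a curve that is C^1
   on a larger open interval. *)
Definition C1_segment (a b : R) (c : R -> M) : Prop :=
  exists c' : R -> M, exists a' b' : R,
    [/\ a' < a, b < b', C1_curve `]a', b'[ c' &
        forall t, a <= t <= b -> c t = c' t].

Definition piecewise_C1 (c : R -> M) : Prop :=
  exists k (t : nat -> R),
    [/\ t 0%N = 0, t k = 1 &
        forall i, (i < k)%N -> t i < t i.+1 /\ C1_segment (t i) (t i.+1) c].

(* The Riemannian distance; it is [+oo] between different components of [M]. *)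
Definition dist (x y : M) : \bar R :=
  ereal_inf [set curve_length c 0 1 |
             c in [set c | [/\ piecewise_C1 c, c 0 = x & c 1 = y]]].

Definition partial (a : 'I_n) (h : 'rV[R]_n -> R) (x : 'rV[R]_n) : R :=
  'D_(delta_mx 0 a) h x.

Definition christoffel (i : atlas M) (x : 'rV[R]_n) (k a b : 'I_n) : R :=
  2^-1 * \sum_(l < n) invmx (gram g i x) k l *
    (partial a (fun y => gram g i y b l) x
     + partial b (fun y => gram g i y a l) x
     - partial l (fun y => gram g i y a b) x).

(* The second derivative is meaningful: as [I] is open, [chart i \o c] is
   derivable near [t]. *)
Definition geodesic_on (I : set R) (c : R -> M) : Prop :=
  open I /\ forall t, I t -> {for t, continuous c} /\
    forall i : atlas M, dom i (c t) ->
      let x := chart i \o c in let x' := derive1 x in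
      [/\ derivable x t 1, derivable x' t 1 &
          forall k, derive1 x' t 0 k
            + \sum_(a < n) \sum_(b < n)
                christoffel i (x t) k a b * x' t 0 a * x' t 0 b = 0].

(* [c] is, on [0, 1], the geodesic with initial velocity [eta] at [p]; the
   maximal geodesic with these data has an open domain, which has to contain
   [0, 1]. *)
Definition geodesic_from (p : M) (eta : tangent p) (c : R -> M) : Prop :=
  exists a b : R,
    [/\ a < 0, 1 < b, geodesic_on `]a, b[ c, c 0 = p &
        velocity c 0 = eta :> 'rV[R]_n].

Definition lipschitz_with (C : R) (G : M -> R) : Prop :=
  forall x y, (`|G x - G y|%:E <= C%:E * dist x y)%E.

End Riemannian.

(* Main.v *)
(* Let [gamma] be the geodesic given by the hypothesis at [f p], for a vector [v].
   Any curve from [q] to [gamma 1] is at least [|G q - G (gamma 1)| / C] long,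
   while [gamma] realises equality at [q = f p].  Since [gamma'(0)] is orthogonal
   to [df_p v], the first variation formula bounds the distance from
   [f (p + s v)] to [gamma 1] by [L(gamma) + o(s)], for [s] of both signs.  Hence
   [s |-> G (f (p + s v))] is, up to [o(s)], bounded from one side by its value at
   [s = 0]; the side depends on the sign of [G (gamma 1) - G (f p)].  A continuous
   function with such a one-sided bound at every point of a segment has the same
   value at both ends, because a continuous function has only countably many local
   maximum values.  So [G \o f] is constant on balls in charts, and by
   connectedness constant. *)
Require Import Defs.
From mathcomp Require Import all_boot all_order all_algebra.
From mathcomp Require Import all_classical all_reals all_analysis.
From mathcomp Require Import measurable_realfun lra ring.

(* [Defs.codom] is otherwise shadowed by [fintype.codom]. *)
Import Defs.
Import Order.TTheory GRing.Theory Num.Theory.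
Import numFieldNormedType.Exports.

Local Open Scope classical_set_scope.
Local Open Scope ring_scope.

Set Implicit Arguments.
Unset Strict Implicit.
Unset Printing Implicit Defensive.

(** * Continuous functions that are flat from one side at every point *)

(** A local maximum value is the maximum of [phi] over some interval with rational end points, and
    there are countably many such intervals. *)
Lemma countable_local_max_values (R : realType) (phi : R -> R) :
  countable [set phi t | t in [set t | \forall s \near t, phi s <= phi t]].
Proof.
pose top (ab : rat * rat) := [set y | (exists2 t, t \in `]ratr ab.1, ratr ab.2[ &
   phi t = y) /\ forall s, s \in `]ratr ab.1, ratr ab.2[ -> phi s <= y].
(* [top ab] has at most one element. Where it is empty, the default 0 only enlarges the countable
   range. *)
apply: (@sub_countable _ _ _ (range (fun ab => xget 0 (top ab)))); last first.
  by apply: card_le_trans (card_image_le _ _) _; exact: countableP.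
apply: subset_card_le => _ [t /= /nbhs_ballP[e /= e0 tmax] <-].
have [a] := @rat_in_itvoo _ (t - e) t ltac:(lra).
have [b] := @rat_in_itvoo _ t (t + e) ltac:(lra).
rewrite !in_itv /= => /andP[tb bt] /andP[ta at'].
exists (a, b) => //; apply: xget_unique.
  split; first by exists t; rewrite // in_itv /= at' tb.
  move=> s; rewrite in_itv /= => /andP[as_ sb]; apply: tmax.
  by rewrite /ball /= ltr_norml; apply/andP; split; lra.
move=> y [[s sab <-] ymax]; apply/eqP; rewrite eq_le.
rewrite [in X in _ && X]ymax ?in_itv /= ?at' ?tb //.
rewrite andbT; apply: tmax; move: sab; rewrite in_itv /= => /andP[as_ sb].
by rewrite /ball /= ltr_norml; apply/andP; split; lra.
Qed.

(** [t] is the infimum of the times in [[0, 1]] at which [phi] is at least [y]; continuity excludes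
    both [phi t < y] and [y < phi t]. *)
Lemma first_hitting_time (R : realType) (phi : R -> R) (y : R) :
    (forall t, 0 <= t <= 1 -> {for t, continuous phi}) ->
    phi 0 < y < phi 1 ->
  exists t, [/\ 0 < t < 1, phi t = y & forall s, 0 <= s < t -> phi s < y].
Proof.
move=> cphi /andP[y0 y1]; pose S := [set t : R | 0 <= t <= 1 /\ y <= phi t].
have S1 : S 1 by split; [lra|exact: ltW].
have iS : has_inf S by split; [exists 1|exists 0 => s [/andP[]]].
set t := inf S.
have t0 : 0 <= t by apply: lb_le_inf; [exists 1|move=> s [/andP[]]].
have t1 : t <= 1 by apply: ge_inf => //; exact: iS.2.
have before s : 0 <= s < t -> phi s < y.
  move=> /andP[s0 st]; rewrite ltNge; apply/negP => ys.
  suff : t <= s by lra.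
  by apply: ge_inf; [exact: iS.2|split=> //; lra].
have ct : phi s @[s --> t] --> phi t by apply: cphi; rewrite t0 t1.
have yt : y <= phi t.
  rewrite leNgt; apply/negP => /(cvgr_lt _ ct)/nbhs_ballP[e /= e0 He].
  have [s [s01 ys] ste] := inf_adherent e0 iS.
  have ts : t <= s by apply: ge_inf => //; exact: iS.2.
  suff : phi s < y by lra.
  apply: He; rewrite /ball /= ltr_norml.
  by apply/andP; split; rewrite /t in ts *; lra.
have tpos : 0 < t.
  by rewrite lt_neqAle t0 andbT; apply/eqP => E; rewrite -E in yt; lra.
have ty : phi t = y.
  apply/eqP; rewrite eq_le yt andbT leNgt; apply/negP.
  move=> /(cvgr_gt _ ct)/nbhs_ballP[e /= e0 He].
  (* A point slightly before [t], cut off at 0 so as to stay in the interval. *)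
  pose s := Num.max 0 (t - e / 2).
  have s0 : 0 <= s by rewrite le_max lexx.
  have st : s < t by rewrite gt_max tpos; lra.
  have se : t - e / 2 <= s by rewrite le_max lexx orbT.
  have := before s; rewrite s0 st => /(_ isT).
  suff : y < phi s by lra.
  by apply: He; rewrite /ball /= ltr_norml; apply/andP; split; lra.
exists t; split=> //; rewrite tpos lt_neqAle t1 andbT.
by apply/eqP => E; move: ty y1; rewrite E; lra.
Qed.

(** This is [h s >= h t - o(|s - t|)], on both sides of [t]. Flatness from above is the same
    property of [- h]. *)
Definition flat_below (R : realType) (h : R -> R) (t : R) :=
  forall e, 0 < e -> \forall s \near t, h t - e * `|s - t| <= h s.

(* If [h 0 < h 1], tilt [h] to [phi t = h t - 2 e t] with [phi 0 < phi 1].  The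
   first time at which [phi] takes a value [y] in between cannot be a point where
   [h] is flat from below, and where [h] is flat from above it is a local maximum
   of [phi].  So every such [y] would be a local maximum value. *)
Lemma le_one_sided_flat (R : realType) (h : R -> R) :
    (forall t, 0 <= t <= 1 -> {for t, continuous h}) ->
    (forall t, 0 <= t <= 1 -> flat_below h t \/ flat_below (fun s => - h s) t) ->
  h 1 <= h 0.
Proof.
move=> ch flat; rewrite leNgt; apply/negP => h01.
(* With this slope, [phi 1 - phi 0 = (h 1 - h 0) / 2] is still positive. *)
pose e := (h 1 - h 0) / 4; have e0 : 0 < e by rewrite /e; lra.
pose phi t := h t - 2 * e * t.
have phi01 : phi 0 < phi 1 by rewrite /phi /e; lra.
have cphi t : 0 <= t <= 1 -> {for t, continuous phi}.
  move=> t01; apply: cvgB; first exact: ch.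
  by apply: cvgM; [exact: cvg_cst|exact: cvg_id].
have Y : `]phi 0, phi 1[ `<=`
    [set phi t | t in [set t | \forall s \near t, phi s <= phi t]].
  move=> y; rewrite /= in_itv /= => yphi.
  have [t [t01 ty before]] := first_hitting_time cphi yphi.
  have t01' : 0 <= t <= 1 by lra.
  exists t => //=.
  have [below|above] := flat t t01'.
    have /nbhs_ballP[d /= d0 Hd] := below e e0.
    (* For [s] just before [t], flatness from below gives [phi s >= phi t + e (t - s) > y], although
       [y] is first reached at [t]. *)
    pose s := Num.max 0 (t - d / 2).
    have s0 : 0 <= s by rewrite le_max lexx.
    have st : s < t by rewrite gt_max; lra.
    have sd : t - d / 2 <= s by rewrite le_max lexx orbT.
    have /Hd : ball t d s by rewrite /ball /= ltr_norml; apply/andP; split; lra.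
    rewrite ltr0_norm ?subr_lt0// => Hs.
    have := before s; rewrite s0 st => /(_ isT).
    by rewrite -ty /phi; nra.
  have near0 : \forall s \near t, 0 < s by apply: lt_nbhsr; lra.
  near=> s.
  (* Before [t], [phi] is below [y = phi t]; after [t], the tilt [2 e (s - t)] outweighs the growth
     [e (s - t)] allowed to [h]. *)
  have [st|ts] := ltP s t.
    apply: ltW; rewrite ty; apply: before; rewrite st andbT; apply: ltW.
    by near: s.
  have : - h t - e * `|s - t| <= - h s by near: s; exact: above.
  by rewrite ger0_norm ?subr_ge0// /phi; nra.
(* The interval []phi 0, phi 1[] would be countable, hence of measure zero, despite its positive
   length. *)
have := sub_countable (subset_card_le Y) (countable_local_max_values phi).
move/countable_lebesgue_measure0; rewrite lebesgue_measure_itv /= lte_fin phi01.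
by move=> /eqP; rewrite -EFinB eqe => /eqP; lra.
Unshelve. all: by end_near. Qed.

Lemma one_sided_flat_eq (R : realType) (h : R -> R) :
    (forall t, 0 <= t <= 1 -> {for t, continuous h}) ->
    (forall t, 0 <= t <= 1 -> flat_below h t \/ flat_below (fun s => - h s) t) ->
  h 1 = h 0.
Proof.
move=> ch flat; apply/eqP; rewrite eq_le le_one_sided_flat//=.
rewrite -lerN2; apply: (@le_one_sided_flat _ (fun s => - h s)).
  by move=> t t01; apply: cvgN; exact: ch.
move=> t /flat[]; [right|by left].
by rewrite (_ : (fun s => - - h s) = h)//; apply/funext => s; rewrite opprK.
Qed.

(** * Charts and C^1 curves *)

Lemma bilinE (R : realType) (n : nat) (A : 'M[R]_n) (u v : 'rV[R]_n) :
  bilin A u v = \sum_j (\sum_i u 0 i * A i j) * v 0 j.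
Proof. by rewrite /bilin !mxE; apply: eq_bigr => j _; rewrite !mxE. Qed.

Lemma bilinDl (R : realType) (n : nat) (A : 'M[R]_n) (u u' v : 'rV[R]_n) :
  bilin A (u + u') v = bilin A u v + bilin A u' v.
Proof. by rewrite /bilin !mulmxDl mxE. Qed.

Lemma bilinDr (R : realType) (n : nat) (A : 'M[R]_n) (u v v' : 'rV[R]_n) :
  bilin A u (v + v') = bilin A u v + bilin A u v'.
Proof. by rewrite /bilin linearD mulmxDr mxE. Qed.

Lemma bilinZl (R : realType) (n : nat) (A : 'M[R]_n) k (u v : 'rV[R]_n) :
  bilin A (k *: u) v = k * bilin A u v.
Proof. by rewrite /bilin -!scalemxAl mxE. Qed.

Lemma bilinZr (R : realType) (n : nat) (A : 'M[R]_n) k (u v : 'rV[R]_n) :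
  bilin A u (k *: v) = k * bilin A u v.
Proof. by rewrite /bilin linearZ /= -scalemxAr mxE. Qed.

Lemma bilinC (R : realType) (n : nat) (A : 'M[R]_n) (u v : 'rV[R]_n) :
  A^T = A -> bilin A u v = bilin A v u.
Proof.
by move=> symA; rewrite /bilin -[in LHS]symA -{1}(trmxK u) -!trmx_mul mxE mulmxA.
Qed.

Lemma cvg_coord (R : realType) (T : Type) (F : set_system T) (FF : Filter F)
    (p q : nat) (u : T -> 'M[R]_(p, q)) (u0 : 'M[R]_(p, q)) i j :
  u x @[x --> F] --> u0 -> u x i j @[x --> F] --> u0 i j.
Proof.
move=> cu; pose coord (N : 'M[R]_(p, q)) := N i j.
by apply: (@continuous_cvg _ _ _ F FF u coord u0) => //; exact: coord_continuous.
Qed.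

Lemma cvg_bilin (R : realType) (n : nat) (T : Type) (F : set_system T)
    (FF : Filter F) (A : T -> 'M[R]_n) (u v : T -> 'rV[R]_n) (A0 : 'M[R]_n)
    (u0 v0 : 'rV[R]_n) :
  (forall a b, A x a b @[x --> F] --> A0 a b) ->
  u x @[x --> F] --> u0 -> v x @[x --> F] --> v0 ->
  bilin (A x) (u x) (v x) @[x --> F] --> bilin A0 u0 v0.
Proof.
move=> cA cu cv; rewrite bilinE.
under eq_fun do rewrite bilinE.
apply: cvg_big => [|j _]; first exact: add_continuous.
apply: cvgM; last exact: cvg_coord.
apply: cvg_big => [|i _]; first exact: add_continuous.
by apply: cvgM => //; exact: cvg_coord.
Qed.

Section Charts.
Variables (R : realType) (n : nat) (M : manifold R n).

Lemma dom_chart (i : atlas M) p : dom i p -> codom i (chart i p).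
Proof. by exists p. Qed.

Lemma codomP (i : atlas M) x : codom i x ->
  dom i (param i x) /\ chart i (param i x) = x.
Proof. by move=> [p ip <-]; rewrite chartK. Qed.

Lemma near_dom (i : atlas M) p : dom i p -> \forall q \near p, dom i q.
Proof. by move=> ip; apply: open_nbhs_nbhs; split => //; exact: dom_open. Qed.

Lemma near_codom (i : atlas M) x : codom i x -> \forall y \near x, codom i y.
Proof. by move=> ip; apply: open_nbhs_nbhs; split => //; exact: codom_open. Qed.

Lemma transition_differentiable (i j : atlas M) p : dom i p -> dom j p ->
  differentiable (chart j \o param i) (chart i p).
Proof.
by move=> ip jp; have [+ _] := transition_smooth i j 1; apply; exists p.
Qed.

Lemma transition_derive_continuous (i j : atlas M) p v : dom i p -> dom j p ->
  {for chart i p, continuous ('D_v (chart j \o param i))}.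
Proof.
by move=> ip jp; have [_ +] := transition_smooth i j 1; apply; exists p.
Qed.

End Charts.

Lemma gram_continuous (R : realType) (n : nat) (M : manifold R n)
    (g : riemannian_metric M) (i : atlas M) (x : 'rV[R]_n) a b :
  codom i x -> {for x, continuous (fun y => gram g i y a b)}.
Proof. by move=> ix; apply: (@gram_smooth _ _ _ g i a b 0). Qed.

Lemma diff_rowE (R : realType) (n : nat) (W : normedModType R)
    (h : 'rV[R]_n -> W) x v : differentiable h x ->
  'd h x v = \sum_j v 0 j *: 'D_('e_j) h x.
Proof.
move=> dh; rewrite [in LHS](row_sum_delta v) linear_sum; apply: eq_bigr => j _.
by rewrite linearZ /= deriveE.
Qed.

Lemma near_eq_continuous (T U : topologicalType) (h k : T -> U) (t : T) :
  (\forall s \near t, h s = k s) -> {for t, continuous k} ->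
  {for t, continuous h}.
Proof.
move=> hk ck; have ht : h t = k t by exact: nbhs_singleton hk.
suff : h s @[s --> t] --> k t by rewrite -ht.
by apply: cvg_trans ck; apply: near_eq_cvg; near do apply/esym.
Unshelve. all: by end_near. Qed.

Lemma near_eq_derive1 (R : realType) (V : normedModType R) (h k : R -> V) t :
  (\forall s \near t, h s = k s) -> derive1 h t = derive1 k t.
Proof. by move=> hk; rewrite !derive1E; exact: near_eq_derive. Qed.

Lemma derivable1_continuous (R : realType) (V : normedModType R) (h : R -> V) t :
  derivable h t 1 -> {for t, continuous h}.
Proof. by move=> /derivable1_diffP; exact: differentiable_continuous. Qed.

Section Curves.
Variables (R : realType) (n : nat) (M : manifold R n) (g : riemannian_metric M).
Implicit Types (i j : atlas M) (c : R -> M) (t a b : R).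

Definition speed c t := Num.sqrt (inner g (velocity c t) (velocity c t)).

(** [speed] reads the velocity in the distinguished chart of the current point, which may jump with
    [t]. Here the chart is fixed, so that continuity can be discussed. *)
Definition chart_speed i (x : R -> 'rV[R]_n) t :=
  Num.sqrt (bilin (gram g i (x t)) (derive1 x t) (derive1 x t)).

(** Near [t] the curve stays in [dom i], so the chain rule applies to the transition map composed
    with [chart i \o c]. *)
Lemma derive1_chart_change i j c t : {for t, continuous c} ->
    dom i (c t) -> dom j (c t) -> derivable (chart i \o c) t 1 ->
  derivable (chart j \o c) t 1 /\
  derive1 (chart j \o c) t =
    'd (chart j \o param i) (chart i (c t)) (derive1 (chart i \o c) t).
Proof.
move=> cc ic jc /derivable1_diffP dc.
have E : \forall s \near t,
    ((chart j \o param i) \o (chart i \o c)) s = (chart j \o c) s.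
  by near=> s => /=; rewrite chartK//; near: s; exact: (cc _ (near_dom ic)).
have dT := transition_differentiable ic jc.
have dTc : differentiable ((chart j \o param i) \o (chart i \o c)) t.
  exact: differentiable_comp.
split; first by apply: near_eq_derivable E _; exact/derivable1_diffP.
by rewrite -(near_eq_derive1 E) derive1E'// diff_comp// derive1E'.
Unshelve. all: by end_near. Qed.

Lemma speed_chart i c t : {for t, continuous c} -> dom i (c t) ->
  derivable (chart i \o c) t 1 -> speed c t = chart_speed i (chart i \o c) t.
Proof.
move=> cc ic dc; rewrite /speed /inner /velocity.
have ac := chart_at_dom (c t).
have [da _] := derive1_chart_change cc ic ac dc.
have [_ E] := derive1_chart_change cc ac ic da.
by rewrite (gram_compat g ac ic) -E.
Qed.

(** In the chart [i] the curve is [x] itself; other charts are reached by the transition maps, which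
    are C^1. *)
Lemma param_C1_curve i (x : R -> 'rV[R]_n) a b :
    (forall t, t \in `]a, b[ -> [/\ codom i (x t), derivable x t 1 &
       {for t, continuous (derive1 x)}]) ->
  C1_curve `]a, b[ (param i \o x).
Proof.
move=> Hx; have cx t : t \in `]a, b[ -> {for t, continuous x}.
  by move=> /Hx[_ /derivable1_continuous].
have cpx t : t \in `]a, b[ -> {for t, continuous (param i \o x)}.
  move=> tab; apply: continuous_comp; first exact: cx.
  by apply: param_continuous; have [] := Hx _ tab.
have chx t : t \in `]a, b[ ->
    \forall s \near t, (chart i \o (param i \o x)) s = x s.
  move=> tab; near=> s; have sab : s \in `]a, b[ by near: s; exact: near_in_itvoo.
  by have [/codomP[]] := Hx _ sab.
have dx t : t \in `]a, b[ -> derivable (chart i \o (param i \o x)) t 1.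
  move=> tab; have [_ d _] := Hx _ tab; apply: near_eq_derivable d.
  by near do apply/esym; exact: chx.
move=> t tab; split=> [|j jx]; first exact: cpx.
have [/codomP[it ixt] dxt cdx] := Hx _ tab.
have [dj _] := derive1_chart_change (cpx _ tab) it jx (dx _ tab).
split; first exact: dj.
pose T := chart j \o param i.
(* Expanding in the standard basis reduces continuity of the derivative to that of the partial
   derivatives of [T] and of the coordinates of [derive1 x]. *)
have E : \forall s \near t, derive1 (chart j \o (param i \o x)) s =
    \sum_k derive1 x s 0 k *: 'D_('e_k) T (x s).
  near=> s; have sab : s \in `]a, b[ by near: s; exact: near_in_itvoo.
  have [/codomP[is_ ixs] _ _] := Hx _ sab.
  have js : dom j ((param i \o x) s) by near: s; exact: (cpx _ tab _ (near_dom jx)).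
  have [_ ->] := derive1_chart_change (cpx _ sab) is_ js (dx _ sab).
  rewrite diff_rowE; last exact: transition_differentiable.
  by rewrite (near_eq_derive1 (chx _ sab)) /= ixs.
apply: near_eq_continuous E _.
apply: cvg_big => [|k _]; first exact: add_continuous.
have cdk : derive1 x s 0 k @[s --> t] --> derive1 x t 0 k.
  exact: (@cvg_coord R R (nbhs t) _ 1 n (derive1 x) (derive1 x t) 0 k cdx).
apply: cvgZ cdk _.
apply: (@continuous_cvg _ _ _ _ _ x ('D_('e_k) T)); last exact: cx.
by rewrite -[x t]ixt; exact: transition_derive_continuous.
Unshelve. all: by end_near. Qed.

Lemma chart_speed_continuous i (x : R -> 'rV[R]_n) t :
  codom i (x t) -> {for t, continuous x} -> {for t, continuous (derive1 x)} ->
  {for t, continuous (chart_speed i x)}.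
Proof.
move=> ix cx cdx; apply: (@continuous_cvg _ _ _ _ _ _ Num.sqrt).
  exact: sqrt_continuous.
apply: cvg_bilin => // k l.
apply: (@continuous_cvg _ _ _ _ _ x (fun y => gram g i y k l)) => //.
exact: gram_continuous.
Qed.

(** The distinguished chart at [c t] computes the speed at all nearby times. *)
Lemma speed_continuous c a b t : C1_curve `]a, b[ c -> t \in `]a, b[ ->
  {for t, continuous (speed c)}.
Proof.
move=> Cc tab; have [cc chc] := Cc _ tab.
have ic := chart_at_dom (c t); set i := chart_at (c t) in ic.
have [dc cdc] := chc i ic.
have E : \forall s \near t, speed c s = chart_speed i (chart i \o c) s.
  near=> s; have sab : s \in `]a, b[ by near: s; exact: near_in_itvoo.
  have is_ : dom i (c s) by near: s; exact: (cc _ (near_dom ic)).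
  by have [cs /(_ i is_)[ds _]] := Cc s sab; apply: speed_chart.
apply: near_eq_continuous E _; apply: chart_speed_continuous => //.
  exact: dom_chart.
exact: derivable1_continuous.
Unshelve. all: by end_near. Qed.

Lemma geodesic_C1_curve a b c : geodesic_on g `]a, b[ c -> C1_curve `]a, b[ c.
Proof.
move=> [_ gc] t /gc[cc chc]; split=> [|i /chc[dc ddc _]]; first exact: cc.
by split; [exact: dc|exact: derivable1_continuous ddc].
Qed.

End Curves.

(** * Lengths and distances *)

(** Open intervals suffice since points are null; a curve with a corner at [tau] has no meaningful
    speed there. *)
Lemma ge0_integral_itv_split (R : realType) (s : R -> R) (tau : R) :
    0 < tau < 1 -> (forall t, 0 <= s t) ->
    measurable_fun `]0, tau[ s -> measurable_fun `]tau, 1[ s ->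
  (\int[lebesgue_measure]_(t in `[0%R, 1%R]) (s t)%:E =
   \int[lebesgue_measure]_(t in `]0%R, tau[) (s t)%:E +
   \int[lebesgue_measure]_(t in `]tau, 1%R[) (s t)%:E)%E.
Proof.
move=> /andP[tau0 tau1] s0 ms1 ms2.
have /(measurable_fun_itv_obnd_cbndP 0) /measurable_fun_itv_bndo_bndcP ms1' := ms1.
have /measurable_fun_itv_bndo_bndcP ms2' := ms2.
rewrite (@itv_bndbnd_setU _ _ _ (BRight tau)) ?bnd_simp ?ltW//.
rewrite ge0_integral_setU//=; last 3 first.
- apply/measurable_funU => //; split; exact/measurable_EFinP.
- by move=> t _; rewrite lee_fin.
- apply/disj_setPLR => t; rewrite /= !in_itv /= => /andP[_ tt] /andP[]; lra.
have /measurable_EFinP ems1 := ms1; have /measurable_EFinP ems2 := ms2.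
congr (_ + _)%E.
  exact: (@integral_itv_bndoo _ _ _ (EFin \o s) true false ems1).
exact: (@integral_itv_bndoo _ _ _ (EFin \o s) false false ems2).
Qed.

(** Serves to compare the speed [s] of a curve with the speed [s'] of its modification up to time
    [tau]. *)
Lemma ge0_le_integral_modified (R : realType) (s s' : R -> R) (tau e : R) :
    0 < tau < 1 -> 0 <= e -> (forall t, 0 <= s t) -> (forall t, 0 <= s' t) ->
    measurable_fun `](0 : R), 1[ s -> measurable_fun `]0, tau[ s' ->
    (forall t, 0 < t < tau -> s' t <= s t + e) ->
    (forall t, tau < t < 1 -> s' t = s t) ->
  (\int[lebesgue_measure]_(t in `[0%R, 1%R]) (s' t)%:E <=
   \int[lebesgue_measure]_(t in `[0%R, 1%R]) (s t)%:E + (tau * e)%:E)%E.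
Proof.
move=> tau01 e0 s0 s0' ms ms' le_s eq_s.
have ms1 : measurable_fun `]0, tau[ s.
  by apply: measurable_funS ms => // t; rewrite /= !in_itv /=; lra.
have ms2 : measurable_fun `]tau, 1[ s.
  by apply: measurable_funS ms => // t; rewrite /= !in_itv /=; lra.
have ms2' : measurable_fun `]tau, 1[ s'.
  by apply: eq_measurable_fun ms2 => t; rewrite inE /= in_itv /= => /eq_s ->.
rewrite !(ge0_integral_itv_split tau01)//.
have -> : (\int[lebesgue_measure]_(t in `]tau, 1%R[) (s' t)%:E =
    \int[lebesgue_measure]_(t in `]tau, 1%R[) (s t)%:E)%E.
  by apply: eq_integral => t; rewrite inE /= in_itv /= => /eq_s ->.
rewrite addeAC leeD2r//.
have -> : (tau * e)%:E = (\int[lebesgue_measure]_(t in `]0%R, tau[) (cst e%:E t))%E.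
  rewrite integral_cst//= lebesgue_measure_itv /= lte_fin.
  by have /andP[-> _] := tau01; rewrite -EFinB -EFinM subr0 mulrC.
rewrite -ge0_integralD//=; last 2 first.
- by move=> t _; rewrite lee_fin.
- exact/measurable_EFinP.
apply: ge0_le_integral => //=.
- by move=> t _; rewrite lee_fin.
- exact/measurable_EFinP.
- by apply: emeasurable_funD => //; exact/measurable_EFinP.
Qed.

Section Distance.
Variables (R : realType) (n : nat) (M : manifold R n) (g : riemannian_metric M).
Implicit Types (i j : atlas M) (c : R -> M) (t a b : R).

Lemma speed_measurable c a b : C1_curve `]a, b[ c ->
  measurable_fun `]a, b[ (speed g c).
Proof.
move=> Cc; apply: open_continuous_measurable_fun => [|t].
  exact: interval_open.
by rewrite inE => tab; exact: speed_continuous Cc tab.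
Qed.

Lemma near_eq_speed c c' t : (\forall s \near t, c s = c' s) ->
  speed g c t = speed g c' t.
Proof.
move=> cc'; rewrite /speed /inner /velocity (nbhs_singleton cc').
have -> // : derive1 (chart (chart_at (c' t)) \o c) t =
  derive1 (chart (chart_at (c' t)) \o c') t.
by apply: near_eq_derive1; near=> s => /=; congr chart; near: s.
Unshelve. all: by end_near. Qed.

Lemma speed_param i (x : R -> 'rV[R]_n) a b t :
    (forall t, t \in `]a, b[ -> [/\ codom i (x t), derivable x t 1 &
       {for t, continuous (derive1 x)}]) ->
  t \in `]a, b[ -> speed g (param i \o x) t = chart_speed g i x t.
Proof.
move=> Hx tab; have [cp chp] := param_C1_curve Hx tab.
have [/codomP[ix ixt] dx _] := Hx t tab.
have E : \forall s \near t, (chart i \o (param i \o x)) s = x s.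
  near=> s; have sab : s \in `]a, b[ by near: s; exact: near_in_itvoo.
  by have [/codomP[]] := Hx _ sab.
rewrite (speed_chart g cp ix); last by have [] := chp i ix.
by rewrite /chart_speed (near_eq_derive1 E) /= ixt.
Unshelve. all: by end_near. Qed.

(** The competitor [c] follows [x] in the chart up to [tau] and [gamma] afterwards; its only
    possible corner is at [tau]. *)
Lemma dist_bridge i (x : R -> 'rV[R]_n) (gamma : R -> M) a b a' b' tau e :
    a < 0 -> 1 < b -> C1_curve `]a, b[ gamma ->
    a' < 0 -> tau < b' ->
    (forall t, t \in `]a', b'[ -> [/\ codom i (x t), derivable x t 1 &
       {for t, continuous (derive1 x)}]) ->
    0 < tau < 1 -> param i (x tau) = gamma tau -> 0 <= e ->
    (forall t, 0 < t < tau -> chart_speed g i x t <= speed g gamma t + e) ->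
  (dist g (param i (x 0%R)) (gamma 1%R) <=
   curve_length g gamma 0%R 1%R + (tau * e)%:E)%E.
Proof.
move=> a0 b1 Cgamma a'0 b'tau Hx tau01 xtau e0 le_speed.
have /andP[tau0 tau1] := tau01.
pose c t := if t <= tau then param i (x t) else gamma t.
have Cx := param_C1_curve Hx.
have cE1 t : t < tau -> \forall s \near t, c s = (param i \o x) s.
  by move=> tt; near=> s; rewrite /c ifT//; apply: ltW; near: s; exact: lt_nbhsl.
have cE2 t : tau < t -> \forall s \near t, c s = gamma s.
  move=> tt; near=> s; rewrite /c ifF//; apply/negbTE; rewrite -ltNge.
  by near: s; exact: lt_nbhsr.
apply: (@le_trans _ _ (curve_length g c 0 1)).
  apply: ereal_inf_lbound; exists c => //; split.
  (* The subdivision is 0, [tau], 1. *)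
  - exists 2%N, (fun k => if k is k'.+1 then if k' is 0%N then tau else 1 else 0).
    split=> // -[|[|//]] _; split=> //.
      exists (param i \o x), a', b'; split=> // t /andP[_ tt].
      by rewrite /c tt.
    exists gamma, a, b; split=> //; first by lra.
    move=> t /andP[tt _]; rewrite /c; case: ifPn => // tt'.
    by have -> : t = tau by apply/eqP; rewrite eq_le tt' tt.
  - by rewrite /c ltW.
  - by rewrite /c leNgt tau1.
have ms : measurable_fun `](0 : R), 1[ (speed g gamma).
  apply: measurable_funS (speed_measurable Cgamma) => // t.
  by rewrite /= !in_itv /=; lra.
have ms' : measurable_fun `]0, tau[ (speed g c).
  apply: (@eq_measurable_fun _ _ _ _ _ (speed g (param i \o x))).
    move=> t; rewrite inE /= in_itv /= => /andP[_ tt].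
    by apply/esym; exact: near_eq_speed (cE1 t tt).
  apply: measurable_funS (speed_measurable Cx) => // t.
  by rewrite /= !in_itv /=; lra.
have speed_ge0 c' t : 0 <= speed g c' t by exact: sqrtr_ge0.
apply: (ge0_le_integral_modified tau01 e0 (speed_ge0 gamma) (speed_ge0 c) ms ms').
  move=> t t0tau; rewrite (near_eq_speed (cE1 t _)); last by lra.
  by rewrite (speed_param Hx) ?le_speed// in_itv /=; lra.
by move=> t ttau1; rewrite (near_eq_speed (cE2 t _)); last by lra.
Unshelve. all: by end_near. Qed.

Lemma dist_chart_curve i (x : R -> 'rV[R]_n) a b K :
    a < 0 -> 1 < b ->
    (forall t, t \in `]a, b[ -> [/\ codom i (x t), derivable x t 1 &
       {for t, continuous (derive1 x)}]) ->
    (forall t, 0 < t < 1 -> chart_speed g i x t <= K) ->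
  (dist g (param i (x 0%R)) (param i (x 1%R)) <= K%:E)%E.
Proof.
move=> a0 b1 Hx leK; have Cx := param_C1_curve Hx.
apply: (@le_trans _ _ (curve_length g (param i \o x) 0 1)).
  apply: ereal_inf_lbound; exists (param i \o x) => //; split=> //.
  exists 1%N, (fun k => k%:R); split=> // -[|//] _; split=> //.
  by exists (param i \o x), a, b; split.
rewrite /curve_length.
have mx : measurable_fun `](0 : R), 1[ (speed g (param i \o x)).
  apply: measurable_funS (speed_measurable Cx) => // t.
  by rewrite /= !in_itv /=; lra.
rewrite integral_itv_bndoo; last exact/measurable_EFinP.
apply: (@le_trans _ _ (\int[lebesgue_measure]_(t in `]0%R, 1%R[) (cst K%:E t))%E).
  have s0 t : t \in `]0, 1[ -> (0 <= (speed g (param i \o x) t)%:E)%E.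
    by rewrite lee_fin sqrtr_ge0.
  have sK t : t \in `]0, 1[ -> ((speed g (param i \o x) t)%:E <= cst K%:E t)%E.
    rewrite in_itv /= => t01; rewrite lee_fin (speed_param Hx) ?leK//.
    by rewrite in_itv /=; lra.
  have /measurable_EFinP emx := mx.
  exact: (ge0_le_integral lebesgue_measure (measurable_itv _) s0 emx
            (measurable_cst _) sK).
by rewrite integral_cst//= lebesgue_measure_itv /= lte_fin ltr01 sube0 mule1.
Qed.

End Distance.

(** * First variation *)

(* With [tau = K r], lowering the speed excess below [e / K] on an interval of
   length [tau] costs at most [e r] in length; the excess itself is O(1 / K^2). *)
Lemma exists_scale (R : realType) (a b e : R) : 0 < a -> 0 <= b -> 0 < e ->
  exists2 K, 0 < K & Num.sqrt (a + K^-1 ^+ 2 * b) < Num.sqrt a + K^-1 * e.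
Proof.
move=> a0 b0 e0; have sa0 : 0 < Num.sqrt a by rewrite sqrtr_gt0.
have q0 : 0 <= b / (Num.sqrt a * e) by rewrite divr_ge0// ltW// mulr_gt0.
(* This [K] gives [b / K < sqrt a * e], so that after squaring the cross term [2 sqrt a * e / K]
   exceeds [b / K^2]. *)
exists (b / (Num.sqrt a * e) + 1); first by lra.
set K := _ + 1; have K0 : 0 < K by rewrite /K; lra.
have Ki0 : 0 < K^-1 by rewrite invr_gt0.
have bK : b < K * (Num.sqrt a * e).
  by rewrite /K mulrDl mul1r divfK ?ltrDl ?mulr_gt0// gt_eqF// mulr_gt0.
have bK' : K^-1 * b < Num.sqrt a * e by rewrite mulrC ltr_pdivrMr// mulrC.
have r0 : 0 < Num.sqrt a + K^-1 * e by rewrite addr_gt0// mulr_gt0.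
rewrite -[ltRHS]gtr0_norm// -sqrtr_sqr ltr_sqrt ?exprn_gt0//.
rewrite sqrrD sqr_sqrtr ?ltW//.
have : K^-1 * (K^-1 * b) < K^-1 * (Num.sqrt a * e) by rewrite ltr_pM2l.
have : 0 < K^-1 * (Num.sqrt a * e) by rewrite !mulr_gt0.
have : 0 < (K^-1 * e) ^+ 2 by rewrite exprn_gt0// mulr_gt0.
by rewrite !expr2 !mulr2n; nra.
Qed.

Lemma is_derive1_affine (R : realType) (V : normedModType R) (c k t : R) (z : V) :
  is_derive t 1 (fun s : R => (c + k * s) *: z) (k *: z).
Proof.
have dk : is_derive t 1 (fun s : R => c + k * s) k.
  by apply: is_derive_eq; rewrite add0r mul1r [_%:A]mulr1.
have dk' : differentiable (fun s : R => c + k * s) t.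
  by apply/derivable1_diffP; case: dk.
have dz : differentiable (fun s : R => (c + k * s) *: z) t.
  exact: differentiableZl.
apply: DeriveDef; first exact/derivable1_diffP.
by rewrite deriveE// diffZl// -deriveE// derive_val.
Qed.

Section Variation.
Variables (R : realType) (n : nat) (M : manifold R n) (g : riemannian_metric M).
Implicit Types (i j : atlas M) (p q : M).

(** By orthogonality, [eta - w / K] has squared norm [|eta|^2 + |w|^2 / K^2], so [exists_scale]
    gives the strict inequality at the base point and continuity spreads it. In [z], the first pair
    holds the points of the shifted curve and of [gamma], the second the velocity of [gamma] and the
    rescaled displacement. *)
Lemma near_chart_speed_le i (x0 eta w : 'rV[R]_n) (e : R) : codom i x0 ->
    eta != 0 -> bilin (gram g i x0) eta w = 0 -> 0 < e ->
  exists2 K, 0 < K &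
  \forall z \near ((x0, x0), (eta, w)),
    Num.sqrt (bilin (gram g i z.1.1) (z.2.1 - K^-1 *: z.2.2)
                                     (z.2.1 - K^-1 *: z.2.2)) <
    Num.sqrt (bilin (gram g i z.1.2) z.2.1 z.2.1) + K^-1 * e.
Proof.
move=> ix0 eta0 etaw e0; pose A0 := gram g i x0.
have weta : bilin A0 w eta = 0 by rewrite bilinC ?gram_sym.
have etaeta := gram_pos g ix0 eta0.
have ww : 0 <= bilin A0 w w.
  have [->|w0] := eqVneq w 0; first by rewrite /bilin mul0mx mul0mx mxE.
  exact: ltW (gram_pos g ix0 w0).
have [K K0 HK] := exists_scale etaeta ww e0; exists K => //.
pose F := nbhs ((x0, x0), (eta, w)).
have FF : Filter F by exact: nbhs_filter.
have c11 : z.1.1 @[z --> F] --> x0.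
  by apply: (@cvg_comp _ _ _ fst fst _ (nbhs (x0, x0))); exact: cvg_fst.
have c12 : z.1.2 @[z --> F] --> x0.
  apply: (@cvg_comp _ _ _ fst snd _ (nbhs (x0, x0))).
    exact: cvg_fst.
  exact: cvg_snd.
have c21 : z.2.1 @[z --> F] --> eta.
  apply: (@cvg_comp _ _ _ snd fst _ (nbhs (eta, w))).
    exact: cvg_snd.
  exact: cvg_fst.
have c22 : z.2.2 @[z --> F] --> w.
  by apply: (@cvg_comp _ _ _ snd snd _ (nbhs (eta, w))); exact: cvg_snd.
have cA (y : ('rV[R]_n * 'rV[R]_n) * ('rV[R]_n * 'rV[R]_n) -> 'rV[R]_n) :
    y z @[z --> F] --> x0 ->
    forall k l, gram g i (y z) k l @[z --> F] --> A0 k l.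
  move=> cy k l.
  apply: (@continuous_cvg _ _ _ _ _ y (fun x => gram g i x k l)) => //.
  exact: gram_continuous.
have cxi : z.2.1 - K^-1 *: z.2.2 @[z --> F] --> eta - K^-1 *: w.
  by apply: cvgB => //; apply: cvgZr.
have cs (Q : _ -> R) (Q0 : R) : Q z @[z --> F] --> Q0 ->
    Num.sqrt (Q z) @[z --> F] --> Num.sqrt Q0.
  move=> cQ; apply: (@continuous_cvg _ _ _ _ _ Q Num.sqrt) => //.
  exact: sqrt_continuous.
have c1 := cs _ _ (cvg_bilin FF (cA _ c11) cxi cxi).
have c2 := cs _ _ (cvg_bilin FF (cA _ c12) c21 c21).
have c3 := cvgB c1 c2.
have Q0E : bilin A0 (eta - K^-1 *: w) (eta - K^-1 *: w) =
    bilin A0 eta eta + K^-1 ^+ 2 * bilin A0 w w.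
  rewrite -scaleNr !(bilinDl, bilinDr, bilinZl, bilinZr) weta.
  by rewrite [bilin A0 eta w]etaw; ring.
have lim_lt : Num.sqrt (bilin A0 (eta - K^-1 *: w) (eta - K^-1 *: w)) -
    Num.sqrt (bilin A0 eta eta) < K^-1 * e by rewrite Q0E ltrBlDl.
apply: filterS (cvgr_lt _ (c3 FF) _ lim_lt) => z.
by rewrite /= -ltrBlDl.
Qed.

(* To go from [q] to [gamma 1], follow [gamma] shifted in the chart by
   [(1 - t / tau) z] up to the time [tau = K r], where [z ~ r w] is the coordinate
   difference of [q] and [p], and [gamma] itself afterwards.  As [tau] shrinks with
   [r], continuity of the metric is enough, and only the C^1 regularity of the
   geodesic is used. *)
Lemma first_variation (p : M) (eta : tangent p) (gamma : R -> M)
    (w : 'rV[R]_n) (e : R) :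
    geodesic_from g eta gamma -> eta != 0 :> 'rV[R]_n ->
    inner g eta (w : tangent p) = 0 -> 0 < e ->
  exists2 d, 0 < d & forall r q, 0 < r < d -> dom (chart_at p) q ->
    `|w - r^-1 *: (chart (chart_at p) q - chart (chart_at p) p)| < d ->
  (dist g q (gamma 1%R) <= curve_length g gamma 0%R 1%R + (e * r)%:E)%E.
Proof.
move=> [a [b [a0 b1 /geodesic_C1_curve Cgamma gamma0 vgamma]]] eta0 etaw e0.
set i := chart_at p; have ip : dom i p := chart_at_dom p.
set x0 := chart i p; have ix0 : codom i x0 := dom_chart ip.
have [K K0 /nbhs_ballP[d1 /= d10 Hd1]] := near_chart_speed_le ix0 eta0 etaw e0.
have /nbhs_ballP[d2 /= d20 Hd2] := near_codom ix0.
pose x := chart i \o gamma.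
have t0ab : 0 \in `]a, b[ by rewrite in_itv /= a0; lra.
have i0 : dom i (gamma 0) by rewrite gamma0.
have [cgamma0 chgamma0] := Cgamma 0 t0ab.
have [dx0 cdx0] := chgamma0 i i0.
have xE0 : x 0 = x0 by rewrite /x /= gamma0.
have dxE0 : derive1 x 0 = eta by rewrite -vgamma /velocity gamma0.
have cx0 := derivable1_continuous dx0.
pose dd := Num.min d1 d2; have dd0 : 0 < dd by rewrite lt_min d10.
have dd1 : dd <= d1 by rewrite ge_min lexx.
have dd2 : dd <= d2 by rewrite ge_min lexx orbT.
have dd20 : 0 < dd / 2 by lra.
have /nbhs_ballP[rho /= rho0 Hrho] : \forall t \near (0 : R),
    [/\ t \in `]a, b[, dom i (gamma t), `|x0 - x t| < dd / 2,
        `|eta - derive1 x t| < d1 & t < 1].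
  near=> t; split; near: t.
  - exact: near_in_itvoo.
  - exact: (cgamma0 _ (near_dom i0)).
  - by rewrite -xE0; apply: cvgr_dist_lt => //; exact: cx0.
  - by rewrite -dxE0; apply: cvgr_dist_lt => //; exact: cdx0.
  - exact: lt_nbhsl.
pose N := `|w| + d1; have N0 : 0 < N by rewrite /N ltr_wpDl.
(* [d1] controls the rescaled displacement, [rho / (2 * K)] ensures [2 tau < rho], and
   [dd / (4 * N)] ensures [2 |z| < dd / 2], as [|z| <= N r]. *)
exists (Num.min d1 (Num.min (rho / (2 * K)) (dd / (4 * N)))).
  by rewrite !lt_min d10 !divr_gt0// mulr_gt0.
move=> r q /andP[r0]; rewrite !lt_min => /and3P[rd1 rrho rdd] iq.
move=> /andP[wd1 _].
set z := chart i q - x0 in wd1 *.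
have {}rrho : 2 * (K * r) < rho.
  by move: rrho; rewrite ltr_pdivlMr ?mulr_gt0//; lra.
have {}rdd : 4 * (N * r) < dd.
  by move: rdd; rewrite ltr_pdivlMr ?mulr_gt0//; lra.
have zE : z = r *: (r^-1 *: z) by rewrite scalerA divff ?gt_eqF// scale1r.
have zN : `|z| <= N * r.
  rewrite zE normrZ gtr0_norm// mulrC ler_pM2r//.
  rewrite -[r^-1 *: z](subKr w) /N (le_trans (ler_normB _ _))// lerD2l.
  exact: ltW.
pose tau := K * r; have tau0 : 0 < tau by rewrite mulr_gt0.
(* [X] starts at the coordinates of [q] and meets [gamma] at [tau]. It is studied on [](- tau), (2 *
   tau)[], an open margin around [[0, tau]] on which the factor of [z] is at most 2 in absolute
   value. *)
pose X t := x t + (1 + - tau^-1 * t) *: z.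
have rho_of t : t \in `](- tau), (2 * tau)[ -> [/\ t \in `]a, b[, dom i (gamma t),
    `|x0 - x t| < dd / 2, `|eta - derive1 x t| < d1 & t < 1].
  rewrite in_itv /= => /andP[ta tb]; apply: Hrho.
  by rewrite /ball /= ltr_norml; apply/andP; split; rewrite /tau in ta tb; lra.
have Xx0 t : t \in `](- tau), (2 * tau)[ -> `|x0 - X t| < dd.
  move=> tt; have [_ _ xt _ _] := rho_of t tt.
  move: tt; rewrite in_itv /= => /andP[ta tb].
  have c2 : `|1 + - tau^-1 * t| <= 2.
    have : tau^-1 * t < 2 by rewrite mulrC ltr_pdivrMr.
    have : - 1 < tau^-1 * t by rewrite mulrC ltr_pdivlMr// mulN1r.
    by rewrite ler_norml => A1 A2; apply/andP; split; lra.
  rewrite /X opprD addrA (le_lt_trans (ler_normB _ _))// normrZ.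
  have : `|1 + - tau^-1 * t| * `|z| <= 2 * (N * r) by rewrite ler_pM.
  by move: xt rdd; lra.
have dxI t : t \in `](- tau), (2 * tau)[ ->
    derivable x t 1 /\ {for t, continuous (derive1 x)}.
  by move=> /rho_of[tab it _ _ _]; have [_ chgt] := Cgamma t tab; exact: chgt.
have dX t : t \in `](- tau), (2 * tau)[ ->
    derivable X t 1 /\ derive1 X t = derive1 x t - tau^-1 *: z.
  move=> /dxI[dxt _]; have [daff affE] := is_derive1_affine 1 (- tau^-1) t z.
  split; first exact: derivableD dxt daff.
  by rewrite !derive1E (deriveD dxt daff) affE scaleNr.
have HX t : t \in `](- tau), (2 * tau)[ -> [/\ codom i (X t), derivable X t 1 &
    {for t, continuous (derive1 X)}].
  move=> tt; split; [|exact: (dX t tt).1|].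
    apply: Hd2; rewrite mx_norm_ball /ball_ /=.
    by apply: lt_le_trans dd2; exact: Xx0.
  apply: (@near_eq_continuous _ _ _ (fun s => derive1 x s - tau^-1 *: z)).
    near=> s; apply: (dX s _).2; near: s; exact: near_in_itvoo.
  by apply: cvgB; [exact: (dxI t tt).2|exact: cvg_cst].
have tauI : tau \in `](- tau), (2 * tau)[ by rewrite in_itv /=; lra.
have [_ itau _ _ tau1] := rho_of tau tauI.
have -> : q = param i (X 0).
  by rewrite /X mulr0 addr0 scale1r xE0 /z addrC subrK chartK.
have -> : e * r = tau * (K^-1 * e).
  by rewrite /tau mulrACA divff ?gt_eqF// mul1r mulrC.
have Ntau0 : - tau < 0 by lra.
have tau2 : tau < 2 * tau by lra.
have tau01 : 0 < tau < 1 by rewrite tau0.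
have Xtau : param i (X tau) = gamma tau.
  by rewrite /X mulNr mulVf ?gt_eqF// subrr scale0r addr0 /x /= chartK.
have Ke0 : 0 <= K^-1 * e by apply: ltW; rewrite mulr_gt0 ?invr_gt0.
apply: (dist_bridge a0 b1 Cgamma Ntau0 tau2 HX tau01 Xtau Ke0).
move=> t t0tau; have tI : t \in `](- tau), (2 * tau)[ by rewrite in_itv /=; lra.
have [tab it xt dxt t1] := rho_of t tI.
have [cgt chgt] := Cgamma t tab; have [dgt _] := chgt i it.
rewrite (speed_chart g cgt it dgt) /chart_speed (dX t tI).2.
have -> : tau^-1 *: z = K^-1 *: (r^-1 *: z) by rewrite scalerA -invfM.
apply: ltW; apply: (Hd1 ((X t, x t), (derive1 x t, r^-1 *: z))).
have ballE (u v : 'rV[R]_n) : `|u - v| < d1 -> ball u d1 v by rewrite mx_norm_ball.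
split; split; apply: ballE; [|lra|exact: dxt|exact: wd1].
by apply: lt_le_trans dd1; exact: Xx0.
Unshelve. all: by end_near. Qed.

End Variation.

(** * The function [G] along the immersion *)

(** For [q] close to [p], the straight coordinate segment joining them is short. *)
Lemma dist_near0 (R : realType) (n : nat) (M : manifold R n)
    (g : riemannian_metric M) (p : M) (e : R) : 0 < e ->
  \forall q \near p, (dist g p q <= e%:E)%E.
Proof.
move=> e0; set i := chart_at p; have ip : dom i p := chart_at_dom p.
set x0 := chart i p; have ix0 : codom i x0 := dom_chart ip.
have /nbhs_ballP[d2 /= d20 Hd2] := near_codom ix0.
(* The speed depends on the point of the segment and on its constant velocity, and tends to 0 at
   [(x0, 0)]; one neighbourhood thus serves all times. *)
pose F := nbhs (x0, 0 : 'rV[R]_n); have FF : Filter F by exact: nbhs_filter.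
have cz : z.2 @[z --> F] --> (0 : 'rV[R]_n) by exact: cvg_snd.
have cy : z.1 @[z --> F] --> x0 by exact: cvg_fst.
have cA k l : gram g i z.1 k l @[z --> F] --> gram g i x0 k l.
  apply: (@continuous_cvg _ _ _ _ _ (fun z => z.1) (fun x => gram g i x k l)) => //.
  exact: gram_continuous.
have := cvg_bilin FF cA cz cz; rewrite {2}/bilin mul0mx mul0mx mxE => cB.
have /(cvgr_lt _) : Num.sqrt (bilin (gram g i z.1) z.2 z.2) @[z --> F] --> (0 : R).
  rewrite -[X in _ --> X](@sqrtr0 R).
  by apply: (@continuous_cvg _ _ _ _ _ _ Num.sqrt) => //; exact: sqrt_continuous.
move=> /(_ e e0)/nbhs_ballP[d1 /= d10 Hd1].
have cp : chart i q @[q --> p] --> x0 by apply: chart_continuous.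
pose d := Num.min d1 d2; have d0 : 0 < d / 2 by rewrite divr_gt0// lt_min d10.
have [dd1 dd2] : d <= d1 /\ d <= d2 by rewrite !ge_min !lexx orbT.
have ballE (u v : 'rV[R]_n) s : `|u - v| < s -> ball u s v by rewrite mx_norm_ball.
near=> q; have iq : dom i q by near: q; exact: near_dom.
have : `|chart i q - x0| < d / 2.
  by near: q; exact: (@cvgr_distC_lt _ _ _ _ _ _ _ cp _ d0).
set z := chart i q - x0 => zd.
pose X t := x0 + (0 + 1 * t) *: z.
have affE t := is_derive1_affine 0 1 t z.
have dX t : derivable X t 1 /\ derive1 X t = z.
  have [daff D] := affE t; have dc := @derivable_cst _ _ _ x0 t 1.
  split; first exact: derivableD dc daff.
  by rewrite derive1E (deriveD dc daff) D derive_cst add0r scale1r.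
have XI t : t \in `](- 1), 2[ -> `|x0 - X t| < d.
  rewrite in_itv /= => /andP[ta tb]; rewrite /X opprD addNKr normrN normrZ.
  have t2 : `|0 + 1 * t| <= 2 by rewrite ler_norml; apply/andP; split; lra.
  have : `|0 + 1 * t| * `|z| <= 2 * `|z| by rewrite ler_pM.
  lra.
have HX t : t \in `](- 1), 2[ -> [/\ codom i (X t), derivable X t 1 &
    {for t, continuous (derive1 X)}].
  move=> tt; split; [|exact: (dX t).1|].
    by apply: Hd2; apply: ballE; apply: lt_le_trans dd2; exact: XI.
  apply: (@near_eq_continuous _ _ _ (fun=> z)); last exact: cvg_cst.
  by near=> s; exact: (dX s).2.
have -> : p = param i (X 0) by rewrite /X mulr0 addr0 scale0r addr0 chartK.
have -> : q = param i (X 1) by rewrite /X add0r mul1r scale1r /z subrKC chartK.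
apply: (dist_chart_curve _ _ HX); [lra|lra|move=> t t01].
rewrite /chart_speed (dX t).2; apply/ltW/(Hd1 (X t, z)).
have tI : t \in `](- 1), 2[ by rewrite in_itv /=; lra.
split; apply: ballE; first by apply: lt_le_trans dd1; exact: XI.
by rewrite sub0r normrN /=; lra.
Unshelve. all: by end_near. Qed.

(** The Lipschitz bound concerns [dist], continuity the topology of [M]; [dist_near0] links them. *)
Lemma lipschitz_with_continuous (R : realType) (n : nat) (M : manifold R n)
    (g : riemannian_metric M) (C : R) (G : M -> R) :
  0 < C -> lipschitz_with g C G -> continuous G.
Proof.
move=> C0 lipG p; apply/cvgrPdist_le => e e0; near=> q.
rewrite -lee_fin (le_trans (lipG p q))// -[e](mulfVK (lt0r_neq0 C0)).
rewrite mulrC EFinM lee_pmul2l//.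
by near: q; apply: dist_near0; rewrite divr_gt0.
Unshelve. all: by end_near. Qed.

Section Immersion.
Variables (R : realType) (m n : nat) (Sigma : manifold R m) (M : manifold R n).
Variables (g : riemannian_metric M) (f : Sigma -> M) (G : M -> R) (C : R).
Hypothesis df : differentiable_map f.
Hypothesis C0 : 0 < C.
Hypothesis lipG : lipschitz_with g C G.
Hypothesis hgeod : forall (p : Sigma) (v : tangent p),
  exists eta : tangent (f p),
    [/\ eta != 0 :> 'rV[R]_n,
        inner g eta (differential f v) = 0 &
        exists gamma : R -> M,
          geodesic_from g eta gamma /\
          (`|G (f p) - G (gamma 1%R)|%:E =
           C%:E * curve_length g gamma 0%R 1%R)%E].

(** [differential] uses the distinguished chart at [p], whereas a coordinate line is followed in one
    chart [i]; the chain rule relates the two. *)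
Lemma differential_transition (i : atlas Sigma) p (v : 'rV[R]_m) : dom i p ->
  differential f ('d (chart (chart_at p) \o param i) (chart i p) v : tangent p) =
  'd (chart (chart_at (f p)) \o f \o param i) (chart i p) v.
Proof.
move=> ip; have [cf dfp] := df p.
set k := chart_at p; set j := chart_at (f p).
have kp : dom k p := chart_at_dom p; have jp : dom j (f p) := chart_at_dom (f p).
have cpi : {for chart i p, continuous (param i)}.
  by apply: param_continuous; exact: dom_chart.
have E : \forall y \near chart i p,
    ((chart j \o f \o param k) \o (chart k \o param i)) y =
    (chart j \o f \o param i) y.
  near=> y => /=; rewrite chartK//.
  by near: y; apply: (cpi); rewrite chartK//; exact: near_dom.
have dT := transition_differentiable ip kp.
have dk := dfp k j kp jp; have di := dfp i j ip jp.
have dk' : differentiable (chart j \o f \o param k)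
    ((chart k \o param i) (chart i p)) by rewrite /= chartK.
have dkT := differentiable_comp dT dk'.
rewrite -(deriveE v di) -(near_eq_derive v E) (deriveE v dkT) (diff_comp dT dk').
rewrite /differential -/k -/j [in RHS]/= (chartK ip).
by [].
Unshelve. all: by end_near. Qed.

Lemma flat_along_line (i : atlas Sigma) (y v : 'rV[R]_m) (t : R) :
  codom i (y + t *: v) ->
  let h s := G (f (param i (y + s *: v))) in
  flat_below h t \/ flat_below (fun s => - h s) t.
Proof.
move=> iyt h; set yt := y + t *: v in iyt.
have [ip chp] := codomP iyt; set p := param i yt in ip chp.
have [cf dfp] := df p.
set j := chart_at (f p); have jp : dom j (f p) := chart_at_dom (f p).
pose Fj := chart j \o f \o param i; pose w := 'd Fj yt v.
have dF : differentiable Fj yt by rewrite -chp; exact: dfp.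
have [eta [eta0 etaw [gamma [geo GL]]]] :=
  @hgeod p ('d (chart (chart_at p) \o param i) (chart i p) v).
rewrite differential_transition// chp -/j -/Fj -/w in etaw.
(* The first variation is stated for [r > 0]; parameters [s < t] are reached with [r = t - s] in the
   direction [- w]. *)
have etaNw : inner g eta (- w : tangent (f p)) = 0.
  by rewrite -scaleN1r /inner bilinZr [bilin _ _ _]etaw mulr0.
pose l := C^-1 * `|G (f p) - G (gamma 1)|.
have LE : curve_length g gamma 0 1 = l%:E.
  by rewrite /l EFinM GL muleA -EFinM mulVf ?mul1e// gt_eqF.
have cline : {for t, continuous (fun s : R => y + s *: v)}.
  by apply: cvgD; [exact: cvg_cst|apply: cvgZr_tmp; exact: cvg_id].
have cpi : {for yt, continuous (param i)} by exact: param_continuous.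
have near_j : \forall s \near t, dom j (f (param i (y + s *: v))).
  have cfi : {for yt, continuous (f \o param i)} by exact: continuous_comp cpi cf.
  have cfl : {for t, continuous ((f \o param i) \o (fun s : R => y + s *: v))}.
    exact: continuous_comp cline cfi.
  exact: (cfl _ (near_dom jp)).
have quot : s^-1 *: (Fj (s *: v + yt) - Fj yt) @[s --> 0^'] --> w.
  rewrite /w -deriveE//; exact: diff_derivable.
have bound e : 0 < e -> \forall s \near t,
    `|G (f (param i (y + s *: v))) - G (gamma 1)| <=
    `|G (f p) - G (gamma 1)| + e * `|s - t|.
  (* The Lipschitz bound multiplies the length excess by [C], whence the tolerance [e / C]. *)
  move=> e0; have e0' : 0 < e / C by rewrite divr_gt0.
  have [d d0 Hd] := first_variation geo eta0 etaw e0'.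
  have [d' d'0 Hd'] := first_variation geo eta0 etaNw e0'.
  have dd0 : 0 < Num.min d d' by rewrite lt_min d0.
  have : \forall s \near (0 : R)^',
      `|w - s^-1 *: (Fj (s *: v + yt) - Fj yt)| < Num.min d d'.
    exact: (@cvgr_dist_lt _ _ _ _ _ _ _ quot _ dd0).
  rewrite near_withinE => /nbhs_ballP[rho /= rho0 Hrho].
  have rho'0 : 0 < Num.min rho (Num.min d d') by rewrite lt_min rho0.
  have near_t : \forall s \near t, `|t - s| < Num.min rho (Num.min d d').
    exact: (@cvgr_dist_lt _ _ _ _ _ _ _ (@cvg_id _ (nbhs t)) _ rho'0).
  near=> s; have js : dom j (f (param i (y + s *: v))) by near: s.
  have : `|t - s| < Num.min rho (Num.min d d') by near: s.
  rewrite !lt_min => /and3P[srho sd sd'].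
  have [->|st] := eqVneq s t; first by rewrite subrr normr0 mulr0 addr0.
  have st0 : s - t != 0 by rewrite subr_eq0.
  have st_rho : ball 0 rho (s - t) by rewrite /ball /= sub0r opprB.
  have := Hrho _ st_rho st0.
  have -> : (s - t) *: v + yt = y + s *: v.
    by rewrite /yt addrCA -scalerDl subrK.
  rewrite lt_min => /andP[wd wd'].
  suff : (dist g (f (param i (y + s *: v))) (gamma 1%R) <=
      l%:E + (e / C * `|s - t|)%:E)%E.
    move=> le_d; rewrite -lee_fin (le_trans (lipG _ _))//.
    apply: (@le_trans _ _ (C%:E * (l%:E + (e / C * `|s - t|)%:E))%E).
      by rewrite lee_pmul2l.
    rewrite -EFinD -EFinM lee_fin mulrDr /l mulVKf ?gt_eqF//.
    by rewrite [C * (_ * _)]mulrA [C * _]mulrCA divff ?gt_eqF// mulr1.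
  rewrite -LE; move: st0; rewrite neq_lt => /orP[st0|st0].
    rewrite ltr0_norm//; apply: Hd' => //.
      by rewrite oppr_gt0 st0 -ltr0_norm// distrC.
    by rewrite invrN scaleNr -opprD normrN.
  rewrite gtr0_norm//; apply: Hd => //.
  by rewrite st0 -[ltLHS]gtr0_norm// distrC.
have htE : h t = G (f p) by [].
(* [bound] says that [h s] is at most [o(|s - t|)] farther from [G (gamma 1)] than [h t] is. This
   bounds [h] from below if [G (gamma 1)] lies above [h t], from above otherwise. *)
have [le_G|lt_G] := leP (G (f p)) (G (gamma 1)).
  have GE : `|G (f p) - G (gamma 1)| = G (gamma 1) - G (f p).
    by rewrite distrC ger0_norm ?subr_ge0.
  left=> e e0; apply: filterS (bound e e0) => s.
  by rewrite GE htE -/(h s) ler_norml => /andP[]; lra.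
have GE : `|G (f p) - G (gamma 1)| = G (f p) - G (gamma 1).
  by rewrite gtr0_norm ?subr_gt0.
right=> e e0; apply: filterS (bound e e0) => s.
by rewrite GE htE -/(h s) ler_norml => /andP[]; lra.
Unshelve. all: by end_near. Qed.

(** The coordinate segment from [p] to a nearby [q] stays in a ball inside [codom i], and
    [one_sided_flat_eq] applies along it. *)
Lemma locally_constant (p : Sigma) :
  \forall q \near p, G (f q) = G (f p).
Proof.
set i := chart_at p; have ip : dom i p := chart_at_dom p.
set y := chart i p; have iy : codom i y := dom_chart ip.
have /nbhs_ballP[e /= e0 He] := near_codom iy.
have cp : chart i q @[q --> p] --> y by apply: chart_continuous.
near=> q; have iq : dom i q by near: q; exact: near_dom.
have : `|y - chart i q| < e.
  by near: q; exact: (@cvgr_dist_lt _ _ _ _ _ _ _ cp _ e0).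
set v := chart i q - y => ve.
have line t : 0 <= t <= 1 -> codom i (y + t *: v).
  move=> /andP[t0 t1]; apply: He; rewrite mx_norm_ball /ball_ /=.
  rewrite opprD addNKr normrN normrZ ger0_norm// -opprB normrN in ve *.
  by rewrite (le_lt_trans _ ve)// ler_piMl.
pose h s := G (f (param i (y + s *: v))).
have cG := lipschitz_with_continuous C0 lipG.
have : h 1 = h 0.
  apply: one_sided_flat_eq => t /line it; last exact: flat_along_line.
  have [cf _] := df (param i (y + t *: v)).
  have cpi := param_continuous it.
  have cfi : {for y + t *: v, continuous (G \o (f \o param i))}.
    apply: continuous_comp; last exact: cG.
    exact: continuous_comp cpi cf.
  have cline : {for t, continuous (fun s : R => y + s *: v)}.
    by apply: cvgD; [exact: cvg_cst|apply: cvgZr_tmp; exact: cvg_id].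
  exact: continuous_comp cline cfi.
by rewrite /h scale1r scale0r addr0 /v subrKC !chartK.
Unshelve. all: by end_near. Qed.

End Immersion.

(** * From local to global constancy *)

(** The level set through [p] is open, closed and nonempty. *)
Lemma connected_locally_constant (T : topologicalType) (A : Type) (h : T -> A) :
  connected [set: T] -> (forall p, \forall q \near p, h q = h p) ->
  forall p q, h q = h p.
Proof.
move=> cT lc p q; pose B := [set q | h q = h p].
have oB : open B.
  rewrite openE => x Bx; apply: filterS (lc x) => z hz.
  by rewrite /B /= hz.
have cB : closed B.
  move=> x /(_ _ (lc x))[z [Bz hz]]; rewrite /B /= -hz; exact: Bz.
suff : B = setT by move=> /(congr1 (fun S => S q)) /= E; change (B q); rewrite E.
apply: cT; first by exists p.
  by exists B => //; rewrite setTI.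
by exists B => //; rewrite setTI.
Qed.

Theorem theorem3 (R : realType) (m n : nat) (Sigma : manifold R m)
    (M : manifold R n) (g : riemannian_metric M) (f : Sigma -> M) (G : M -> R)
    (C : R)
    (hSigma : connected [set: Sigma])
    (hf : immersion f)
    (hC : 0 < C)
    (hG : lipschitz_with g C G)
    (hgeod : forall (p : Sigma) (v : tangent p),
      exists eta : tangent (f p),
        [/\ eta != 0 :> 'rV[R]_n,
            inner g eta (differential f v) = 0 &
            exists gamma : R -> M,
              geodesic_from g eta gamma /\
              (`|G (f p) - G (gamma 1)|%:E = C%:E * curve_length g gamma 0 1)%E]) :
  exists c : R, f @` [set: Sigma] `<=` G @^-1` [set c].
Proof.
have [df _] := hf; have lc := locally_constant df hC hG hgeod.
(* An empty [Sigma] has no base point, but then its image is empty and any constant works. *)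
have [[p0 _]|noS] := pselect (exists p : Sigma, True); last first.
  by exists 0 => ? [p]; case: noS; exists p.
exists (G (f p0)) => _ [p _ <-] /=.
exact: (connected_locally_constant (h := G \o f) hSigma lc).
Qed.
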